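(* Let $f:\operatorname{dom} f\subseteq\mathbb{R}^n\to\mathbb{R}$ be $\mathcal{C}^4$ on an open domain containing $B(x^0;\Delta_S)$, where $x^0\in\operatorname{dom} f$ is the point of interest and $\Delta_S=\max_{i\in\{1,\dots,k\}}\Vert s^i\Vert>0$ is the radius of the matrix $S=\begin{bmatrix}s^1&s^2&\cdots&s^k\end{bmatrix}\in\mathbb{R}^{n\times k}$. Let $W=S\odot S\in\mathbb{R}^{n\times k}$ and $\widetilde{W}=W/\Delta_S^2$. Denote by $L_{\nabla^3 f}\ge 0$ the Lipschitz constant of $\nabla^3 f$ on $B(x^0;\Delta_S)$. If $S$ is a lonely matrix with full row rank, then $$\left\Vert \operatorname{diag}\left[\nabla^2_c f(x^0;S)\right]-\operatorname{diag}\left[\nabla^2 f(x^0)\right]\right\Vert\le \left\Vert(\widetilde{W}^\top)^\dagger\right\Vert\frac{\sqrt{k}}{12}L_{\nabla^3 f}\,\Delta_S^2.$$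
   Context: Vector norms are Euclidean ($\ell_2$) and matrix norms are the induced $\ell_2$ operator norms. $B(x^0;\Delta)$ is the closed ball of radius $\Delta$ centered at $x^0$. The third derivative $\nabla^3 f(x)$ is regarded as a symmetric trilinear form on $\mathbb{R}^n$, and Lipschitz continuity of $\nabla^3 f$ is with respect to the norm on trilinear forms induced by the Euclidean norm. $A\odot B$ is the Hadamard (entrywise) product of matrices of the same size. $A^\dagger$ is the Moore--Penrose pseudoinverse of $A$. For a square matrix $M\in\mathbb{R}^{n\times n}$, $\operatorname{diag}[M]\in\mathbb{R}^n$ is the vector of its diagonal entries. Lonely matrix: a matrix $S\in\mathbb{R}^{n\times k}$ is a lonely matrix if there is exactly one nonzero entry in each column of $S$. Centered simplex Hessian diagonal (CSHD): for $f$, $x^0\in\operatorname{dom} f$, and $S=\begin{bmatrix}s^1&\cdots&s^k\end{bmatrix}\in\mathbb{R}^{n\times k}$ with $x^0\pm s^i\in\operatorname{dom} f$ for all $i$, let $W=S\odot S=\begin{bmatrix}s^1\odot s^1&\cdots&s^k\odot s^k\end{bmatrix}$ and let $\varepsilon_f(x^0;S)\in\mathbb{R}^k$ be the vector with $i$-th entry $f(x^0+s^i)+f(x^0-s^i)-2f(x^0)$. The CSHD of $f$ at $x^0$ over $S$ is the vector in $\mathbb{R}^n$ $$\operatorname{diag}\left[\nabla^2_c f(x^0;S)\right]=(W^\top)^\dagger\,\varepsilon_f(x^0;S).$$ *)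

(* Defs.v *)
From HB Require Import structures.
From mathcomp Require Import all_boot all_order all_algebra.
From mathcomp Require Import all_classical all_reals all_analysis.
Set Implicit Arguments. Unset Strict Implicit. Unset Printing Implicit Defensive.
Import Order.TTheory GRing.Theory Num.Theory.
Import numFieldNormedType.Exports.
Local Open Scope classical_set_scope.
Local Open Scope ring_scope.

(* The library norm `|v| on matrices is the sup norm (it induces the same
   topology), hence the explicit Euclidean and operator norms. *)
Definition enorm (R : realType) n (v : 'cV[R]_n) : R :=
  Num.sqrt (\sum_i v i 0 ^+ 2).

Definition opnorm (R : realType) m n (A : 'M[R]_(m, n)) : R :=
  sup [set enorm (A *m v) | v in [set v : 'cV[R]_n | enorm v <= 1]].

Definition trinorm (R : realType) n
    (T : 'cV[R]_n -> 'cV[R]_n -> 'cV[R]_n -> R) : R :=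
  sup [set r : R | exists u v w : 'cV[R]_n,
    [/\ enorm u <= 1, enorm v <= 1, enorm w <= 1 & r = `|T u v w|]].

Definition ecball (R : realType) n (x : 'cV[R]_n) (r : R) : set 'cV[R]_n :=
  [set y | enorm (y - x) <= r].

Definition partial (R : realType) n (i : 'I_n) (f : 'cV[R]_n -> R) :
    'cV[R]_n -> R :=
  fun x => 'D_(delta_mx i 0) f x.

(* f is C^p on the open set U: all partial derivatives of order at most p
   exist and are continuous on U. *)
Fixpoint Ck (R : realType) n (p : nat) (U : set 'cV[R]_n)
    (f : 'cV[R]_n -> R) : Prop :=
  (forall x, U x -> {for x, continuous f}) /\
  (if p is q.+1 then
     forall i : 'I_n, (forall x, U x -> derivable f x (delta_mx i 0)) /\
                      Ck q U (partial i f)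
   else True).

Definition hessian (R : realType) n (f : 'cV[R]_n -> R) (x : 'cV[R]_n) :
    'M[R]_n :=
  \matrix_(i, j) partial i (partial j f) x.

Definition D3 (R : realType) n (f : 'cV[R]_n -> R) (x u v w : 'cV[R]_n) : R :=
  \sum_i \sum_j \sum_l
    partial i (partial j (partial l f)) x * u i 0 * v j 0 * w l 0.

Definition D3_lipschitz (R : realType) n (f : 'cV[R]_n -> R)
    (B : set 'cV[R]_n) (L : R) : Prop :=
  forall x y, B x -> B y ->
    trinorm (fun u v w => D3 f x u v w - D3 f y u v w) <= L * enorm (x - y).

Definition hadamard (R : realType) m n (A B : 'M[R]_(m, n)) : 'M[R]_(m, n) :=
  map2_mx *%R A B.

Definition diagv (R : realType) n (M : 'M[R]_n) : 'cV[R]_n := \col_i M i i.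

Definition penrose (R : realType) m n (A : 'M[R]_(m, n)) (X : 'M[R]_(n, m)) :
    Prop :=
  [/\ A *m X *m A = A, X *m A *m X = X,
      (A *m X)^T = A *m X & (X *m A)^T = X *m A].

(* Moore-Penrose pseudoinverse: the matrix satisfying the Penrose conditions,
   which exists and is unique by mpinvP and penrose_uniq. *)
Definition mpinv (R : realType) m n (A : 'M[R]_(m, n)) : 'M[R]_(n, m) :=
  xget 0 [set X | penrose A X].

Lemma penrose_uniq (R : realType) m n (A : 'M[R]_(m, n)) X Y :
  penrose A X -> penrose A Y -> X = Y.
Proof.
move=> [X1 X2 X3 X4] [Y1 Y2 Y3 Y4].
have e1 : A *m X = A *m Y.
  by rewrite -X3 -[in LHS]Y1 -mulmxA trmx_mul X3 Y3 mulmxA X1.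
have e2 : X *m A = Y *m A.
  by rewrite -X4 -[in LHS]Y1 -mulmxA mulmxA trmx_mul Y4 X4 -mulmxA (mulmxA A) X1.
by rewrite -X2 e2 -mulmxA e1 mulmxA Y2.
Qed.

Lemma gram_unit (R : realType) m n (A : 'M[R]_(m, n)) :
  row_free A -> A *m A^T \in unitmx.
Proof.
move=> fA; rewrite -row_free_unit -kermx_eq0; apply/eqP/row_matrixP => i.
rewrite row0; set u := row i _.
have uAA : u *m (A *m A^T) = 0 by rewrite -row_mul mulmx_ker row0.
have uA : u *m A = 0.
  have: (u *m A) *m (u *m A)^T = 0 by rewrite trmx_mul !mulmxA -(mulmxA u) uAA mul0mx.
  move=> /matrixP/(_ 0 0); rewrite !mxE.
  under eq_bigr do rewrite [_^T _ _]mxE -expr2.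
  move/eqP; rewrite psumr_eq0 => [/allP h|j _]; last exact: sqr_ge0.
  apply/rowP => j; rewrite [RHS]mxE; apply/eqP.
  by have := h j (mem_index_enum j); rewrite /= sqrf_eq0.
by apply: (row_free_inj fA); rewrite uA mul0mx.
Qed.

Lemma penrose_ex (R : realType) m n (A : 'M[R]_(m, n)) : exists X, penrose A X.
Proof.
have [r [C [F [AE fF fC]]]] : exists r (C : 'M[R]_(m, r)) (F : 'M[R]_(r, n)),
    [/\ A = C *m F, row_free F & row_free C^T].
  exists (\rank A), (col_base A), (row_base A); split; first by rewrite mulmx_base.
    exact: row_base_free.
  by rewrite /row_free mxrank_tr; exact: col_base_full.
have uF : F *m F^T \in unitmx by exact: gram_unit.
have uC : C^T *m C \in unitmx by rewrite -[X in _ *m X]trmxK; exact: gram_unit.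
pose H := invmx (F *m F^T); pose G := invmx (C^T *m C).
have HT : H^T = H by rewrite trmx_inv trmx_mul trmxK.
have GT : G^T = G by rewrite trmx_inv trmx_mul trmxK.
have FH : F *m F^T *m H = 1%:M by exact: mulmxV.
have GC : G *m (C^T *m C) = 1%:M by exact: mulVmx.
pose X := F^T *m H *m (G *m C^T).
have AX : A *m X = C *m G *m C^T.
  by rewrite AE /X -!mulmxA (mulmxA F) (mulmxA (F *m F^T)) FH mul1mx.
have XA : X *m A = F^T *m H *m F.
  by rewrite AE /X -!mulmxA (mulmxA C^T) (mulmxA G) GC mul1mx.
exists X; split.
- by rewrite AX AE -!mulmxA (mulmxA C^T) (mulmxA G) GC mul1mx.
- by rewrite XA /X -!mulmxA (mulmxA F) (mulmxA (F *m F^T)) FH mul1mx.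
- by rewrite AX !trmx_mul trmxK GT mulmxA.
- by rewrite XA !trmx_mul trmxK HT mulmxA.
Qed.

Lemma mpinvP (R : realType) m n (A : 'M[R]_(m, n)) : penrose A (mpinv A).
Proof. by have [X pX] := penrose_ex A; exact: (xgetI 0 pX). Qed.

Definition mx_radius (R : realType) n k (S : 'M[R]_(n, k)) : R :=
  \big[Num.max/0]_(i < k) enorm (col i S).

Definition lonely (R : realType) n k (S : 'M[R]_(n, k)) : Prop :=
  forall j : 'I_k, exists! i : 'I_n, S i j != 0.

Definition eps_f (R : realType) n k (f : 'cV[R]_n -> R) (x0 : 'cV[R]_n)
    (S : 'M[R]_(n, k)) : 'cV[R]_k :=
  \col_i (f (x0 + col i S) + f (x0 - col i S) - 2 * f x0).

(* Centered simplex Hessian diagonal of f at x0 over S. *)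
Definition cshd (R : realType) n k (f : 'cV[R]_n -> R) (x0 : 'cV[R]_n)
    (S : 'M[R]_(n, k)) : 'cV[R]_n :=
  mpinv (hadamard S S)^T *m eps_f f x0 S.

(* Main.v *)
Require Import Defs.
From HB Require Import structures.
From mathcomp Require Import all_boot all_order all_algebra.
From mathcomp Require Import all_classical all_reals all_analysis.
From mathcomp Require Import ring lra.
(* Each column of a lonely matrix is a multiple c of a basis vector e, so f is
   only sampled along coordinate axes, and W has full row rank like S, whence
   (W^T)^+ W^T = 1. The error is therefore (W^T)^+ r, where each entry of r is
   f (x0 + c e) + f (x0 - c e) - 2 f x0 - c^2 H_ee. The third derivative of this
   entry in c is an odd difference of the third partial derivative along e, at
   most 2 L |c| by the Lipschitz condition; integrating three times bounds the
   entry by L c^4 / 12. *)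

Set Implicit Arguments. Unset Strict Implicit.
Unset Printing Implicit Defensive.
Import Order.TTheory GRing.Theory Num.Theory.
Import numFieldNormedType.Exports.
Local Open Scope classical_set_scope.
Local Open Scope ring_scope.

(** * The Euclidean norm and its operator norm *)

Section EuclideanNorm.
Variable R : realType.
Implicit Types m n : nat.

Lemma enorm_ge0 n (v : 'cV[R]_n) : 0 <= enorm v.
Proof. exact: sqrtr_ge0. Qed.

Lemma enormZ n (a : R) (v : 'cV[R]_n) : enorm (a *: v) = `|a| * enorm v.
Proof.
rewrite /enorm -sqrtr_sqr -sqrtrM ?sqr_ge0// mulr_sumr.
by congr Num.sqrt; apply: eq_bigr => i _; rewrite mxE exprMn.
Qed.

Lemma enorm0_eq0 n (v : 'cV[R]_n) : enorm v = 0 -> v = 0.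
Proof.
move=> /eqP; rewrite sqrtr_eq0 => h.
have /eqP : \sum_i v i 0 ^+ 2 = 0.
  by apply/eqP; rewrite eq_le h sumr_ge0// => i _; exact: sqr_ge0.
rewrite psumr_eq0 => [/allP z|i _]; last exact: sqr_ge0.
apply/colP => i; rewrite mxE; apply/eqP.
by have := z i (mem_index_enum i); rewrite /= sqrf_eq0.
Qed.

Lemma enorm_delta n (i : 'I_n) : enorm (delta_mx i 0 : 'cV[R]_n) = 1.
Proof.
rewrite /enorm (bigD1 i)//= mxE !eqxx expr1n big1 ?addr0 ?sqrtr1// => j ji.
by rewrite mxE (negbTE ji) expr0n.
Qed.

Lemma coord_le_enorm n (v : 'cV[R]_n) i : `|v i 0| <= enorm v.
Proof.
rewrite -sqrtr_sqr ler_wsqrtr// (bigD1 i)//= lerDl.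
by apply: sumr_ge0 => j _; exact: sqr_ge0.
Qed.

(** Source of the factor [Num.sqrt k%:R] in the final bound: it turns a uniform estimate on the
    entries of the residual into a Euclidean one. *)
Lemma enorm_le_bound n (v : 'cV[R]_n) (M : R) :
  0 <= M -> (forall i, `|v i 0| <= M) -> enorm v <= Num.sqrt n%:R * M.
Proof.
move=> M0 vM; rewrite -[in leRHS](ger0_norm M0) -sqrtr_sqr -sqrtrM ?ler0n//.
apply: ler_wsqrtr.
have -> : n%:R * M ^+ 2 = \sum_(i < n) M ^+ 2.
  by rewrite sumr_const card_ord mulr_natl.
apply: ler_sum => i _; rewrite -(real_normK (num_real (v i 0))).
by rewrite ler_pXn2r// nnegrE.
Qed.

(** [sup] is an upper bound only for a set that has one. Coordinates of a vector in the unit ball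
    are at most 1 in absolute value, so the sum of all [|A i j|] bounds every coordinate of the
    image. *)
Lemma opnorm_set_bounded n m (A : 'M[R]_(m, n)) :
  has_ubound [set enorm (A *m v) | v in [set v : 'cV[R]_n | enorm v <= 1]].
Proof.
exists (Num.sqrt m%:R * \sum_i \sum_j `|A i j|) => _ [u /= u1 <-].
apply: enorm_le_bound => [|i].
  by apply: sumr_ge0 => i _; apply: sumr_ge0.
rewrite mxE (bigD1 i)//=; apply: le_trans (ler_norm_sum _ _ _) _.
apply: ler_wpDr; first by apply: sumr_ge0 => l _; apply: sumr_ge0.
apply: ler_sum => j _; rewrite normrM ler_piMr//.
exact: le_trans (coord_le_enorm u j) u1.
Qed.

Lemma enorm0 n : enorm (0 : 'cV[R]_n) = 0.
Proof. by rewrite -(scale0r 0) enormZ normr0 mul0r. Qed.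

Lemma opnorm_ge0 n m (A : 'M[R]_(m, n)) : 0 <= opnorm A.
Proof.
by apply: ub_le_sup (opnorm_set_bounded A) _ _; exists 0; rewrite /= ?mulmx0 enorm0.
Qed.

Lemma enorm_mulmx_le n m (A : 'M[R]_(m, n)) (v : 'cV[R]_n) :
  enorm (A *m v) <= opnorm A * enorm v.
Proof.
have ub := opnorm_set_bounded A.
have [v0|v0] := eqVneq (enorm v) 0.
  by rewrite v0 mulr0 (enorm0_eq0 v0) mulmx0 enorm0.
have vgt0 : 0 < enorm v by rewrite lt_def v0 enorm_ge0.
have vE : v = enorm v *: ((enorm v)^-1 *: v) by rewrite scalerA divff// scale1r.
rewrite [in leLHS]vE -scalemxAr enormZ gtr0_norm// mulrC ler_wpM2r ?enorm_ge0//.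
apply: ub_le_sup => //; exists ((enorm v)^-1 *: v) => //=.
by rewrite enormZ gtr0_norm ?invr_gt0// mulVf.
Qed.

End EuclideanNorm.

(** * Scaling and one-sided inversion for the pseudoinverse *)

Section Pseudoinverse.
Variable R : realType.

Lemma mpinvZ m n (a : R) (A : 'M[R]_(m, n)) :
  a != 0 -> mpinv (a *: A) = a^-1 *: mpinv A.
Proof.
move=> a0; have [h1 h2 h3 h4] := mpinvP A.
apply: (penrose_uniq (mpinvP _)); split;
  rewrite -!scalemxAr -!scalemxAl !scalerA.
- by rewrite divff// mul1r h1.
- by rewrite mulVf// mul1r h2.
- by rewrite mulVf// !scale1r.
- by rewrite divff// !scale1r.
Qed.

(** Transposing the first Penrose condition for [A^T] gives an identity of the form [X *m A = A],
    and a row-free [A] can be cancelled on the right. *)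
Lemma mul_mpinv_trmx m n (A : 'M[R]_(m, n)) :
  row_free A -> mpinv A^T *m A^T = 1%:M.
Proof.
move=> fA; have [h _ _ _] := mpinvP A^T.
apply: trmx_inj; rewrite trmx1; apply: (row_free_inj fA).
by rewrite mul1mx trmx_mul trmxK -[in RHS](trmxK A) -[in RHS]h !trmx_mul !trmxK mulmxA.
Qed.

End Pseudoinverse.

(** * Columns and rank of lonely matrices *)

Section LonelyMatrix.
Variable R : realType.

Lemma lonely_col n k (S : 'M[R]_(n, k)) j :
  lonely S -> exists i, col j S = S i j *: delta_mx i 0.
Proof.
move=> /(_ j)[i [_ uniqi]]; exists i; apply/colP => l; rewrite !mxE andbT.
have [->|li] := eqVneq l i; first by rewrite mulr1.
rewrite mulr0; apply/eqP; apply: contraNT li => Slj.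
by rewrite (uniqi l Slj).
Qed.

(** If the only nonzero entry of column [j] is in row [i], then entry [j] of [u *m hadamard S S] is
    [u i * S i j ^+ 2], and that of [u *m S] is [u i * S i j]. They vanish together, so both
    matrices have the same left kernel. *)
Lemma row_free_hadamard n k (S : 'M[R]_(n, k)) :
  lonely S -> row_free S -> row_free (hadamard S S).
Proof.
move=> lS fS; rewrite -kermx_eq0; apply/eqP/row_matrixP => r.
rewrite row0; set u := row r _.
have : u *m hadamard S S = 0 by rewrite -row_mul mulmx_ker row0.
move: u => {r} u uW.
apply: (row_free_inj fS); rewrite mul0mx; apply/rowP => j; rewrite !mxE.
have [i /colP Si] := lonely_col j lS.
have Sj l : S l j = S i j * (l == i)%:R.
  by have := Si l; rewrite !mxE andbT.
have := congr1 (fun M : 'rV_k => M 0 j) uW; rewrite !mxE.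
rewrite (bigD1 i)//= big1 => [|l li]; last first.
  by rewrite mxE Sj (negbTE li) mulr0 mul0r mulr0.
rewrite (bigD1 i)//= [in X in _ -> X]big1 => [|l li]; last first.
  by rewrite Sj (negbTE li) mulr0 mulr0.
rewrite mxE !addr0 => /eqP; rewrite !mulf_eq0 orbb => /orP[]/eqP->;
  by rewrite ?mul0r ?mulr0.
Qed.

End LonelyMatrix.

(** * One-variable Taylor estimates *)

Section Taylor.
Variable R : realType.
Implicit Types (f h dh : R -> R) (a c t : R).

(** Integration of a power bound without integrals: the mean value theorem is applied to the
    difference of the claimed bound and [h]. *)
Lemma deriv_bound_integrate h dh a c (n : nat) :
  h 0 = 0 ->
  (forall t, 0 <= t <= c -> is_derive t 1 h (dh t)) ->
  (forall t, 0 <= t <= c -> `|dh t| <= a * t ^+ n) ->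
  forall t, 0 <= t <= c -> `|h t| <= a / n.+1%:R * t ^+ n.+1.
Proof.
move=> h0 dhP bnd t /andP[t0 tc].
have n0 : n.+1%:R != 0 :> R by rewrite pnatr_eq0.
(* The sign [s] covers both halves of the absolute value at once; it is used with 1 and -1. *)
have main (s : R) : `|s| = 1 -> s * h t <= a / n.+1%:R * t ^+ n.+1.
  move=> s1; pose F x : R := a / n.+1%:R * x ^+ n.+1 - s * h x.
  pose dF x : R := a * x ^+ n - s * dh x.
  have FP x : 0 <= x <= t -> is_derive x 1 F (dF x).
    move=> /andP[x0 xt].
    have dx : is_derive x 1 h (dh x) by apply: dhP; rewrite x0 (le_trans xt tc).
    have -> : F = ((a / n.+1%:R) \*: (@id R ^+ n.+1)) - (s \*: h).
      by apply/funext => y; rewrite /F !fctE.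
    apply: is_derive_eq; rewrite /dF /GRing.scale/= mulr1.
    by rewrite mulrA divfK.
  have [||x xt] := MVT_segment t0 (f := F) (df := dF).
  - by move=> x; rewrite in_itv/= => /andP[x0 xt]; apply: FP; rewrite !ltW.
  - apply: derivable_within_continuous => x; rewrite in_itv/= => xt.
    by have [] := FP x xt.
  (* Since [F] vanishes at 0, the mean value identity reads [F t = dF x * t], and [dF x] is
     nonnegative by [bnd]. *)
  rewrite {1 2}/F h0 mulr0 expr0n mulr0 !subr0 => E.
  rewrite -subr_ge0 E mulr_ge0// /dF subr_ge0.
  move: xt; rewrite in_itv/= => /andP[x0 xt].
  apply: le_trans (ler_norm _) _; rewrite normrM s1 mul1r.
  by apply: bnd; rewrite x0 (le_trans xt tc).
rewrite ler_norml lerNl -mulN1r -[X in _ && (X <= _)]mul1r.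
by rewrite !main ?normrN ?normr1.
Qed.

Lemma is_derive_reflect f t df :
  is_derive (- t) 1 f df -> is_derive t 1 (fun x => f (- x)) (- df).
Proof.
move=> d; rewrite -mulrN1.
exact: (@is_derive1_comp _ f -%R).
Qed.

(** The Lipschitz bound on [g3] does the work of a bound on a fourth derivative. *)
Lemma second_difference_bound (g g1 g2 g3 : R -> R) (L c : R) :
  (forall t, `|t| <= `|c| -> is_derive t 1 g (g1 t)) ->
  (forall t, `|t| <= `|c| -> is_derive t 1 g1 (g2 t)) ->
  (forall t, `|t| <= `|c| -> is_derive t 1 g2 (g3 t)) ->
  (forall s t, `|s| <= `|c| -> `|t| <= `|c| ->
     `|g3 s - g3 t| <= L * `|s - t|) ->
  `|g c + g (- c) - 2 * g 0 - c ^+ 2 * g2 0| <= L / 12 * c ^+ 4.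
Proof.
(* Both sides are even in [c]. *)
wlog c0 : c / 0 <= c => [wl|] d1 d2 d3 lip.
  have [c0|c0] := leP 0 c; first exact: wl.
  have := wl (- c); rewrite normrN opprK sqrrN oppr_ge0 (ltW c0).
  rewrite (addrC (g (- c))) -[(- c) ^+ 4]/((- c) ^+ (2 * 2)) exprM sqrrN -exprM.
  by apply.
have in1 t : 0 <= t <= c -> `|t| <= `|c|.
  by case/andP => t0 tc; rewrite !ger0_norm.
have in2 t : 0 <= t <= c -> `|- t| <= `|c| by rewrite normrN; exact: in1.
have cc : 0 <= c <= c by rewrite c0 lexx.
(* [h0] is the quantity to bound, with [c] replaced by a variable; [h1], [h2], [h3] are its
   successive derivatives. The subtracted terms make [h0], [h1] and [h2] vanish at 0, as each
   integration requires. *)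
pose h0 t := g t + g (- t) - (2 * g 0 + g2 0 * t ^+ 2).
pose h1 t := g1 t - g1 (- t) - 2 * g2 0 * t.
pose h2 t := g2 t + g2 (- t) - 2 * g2 0.
pose h3 t := g3 t - g3 (- t).
have b3 t : 0 <= t <= c -> `|h3 t| <= 2 * L * t ^+ 1.
  move=> tc; have /andP[t0 _] := tc.
  apply: le_trans (lip _ _ (in1 _ tc) (in2 _ tc)) _.
  by rewrite opprK ger0_norm ?addr_ge0// expr1; lra.
have D2 t : 0 <= t <= c -> is_derive t 1 h2 (h3 t).
  move=> tc; have := d3 _ (in1 _ tc).
  have := is_derive_reflect (d3 _ (in2 _ tc)).
  move=> e1 e2.
  have -> : h2 = g2 + (fun x => g2 (- x)) - cst (2 * g2 0) by [].
  by apply: is_derive_eq; rewrite subr0.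
have D1 t : 0 <= t <= c -> is_derive t 1 h1 (h2 t).
  move=> tc; have := d2 _ (in1 _ tc).
  have := is_derive_reflect (d2 _ (in2 _ tc)).
  move=> e1 e2.
  have -> : h1 = g1 - (fun x => g1 (- x)) - ((2 * g2 0) \*: @id R) by [].
  by apply: is_derive_eq; rewrite /h2 /GRing.scale/=; ring.
have D0 t : 0 <= t <= c -> is_derive t 1 h0 (h1 t).
  move=> tc; have := d1 _ (in1 _ tc).
  have := is_derive_reflect (d1 _ (in2 _ tc)).
  move=> e1 e2.
  have -> : h0 = g + (fun x => g (- x)) - (cst (2 * g 0) + g2 0 \*: (@id R ^+ 2)) by [].
  by apply: is_derive_eq; rewrite /h1 /GRing.scale/=; ring.
have h20 : h2 0 = 0 by rewrite /h2 oppr0; ring.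
have h10 : h1 0 = 0 by rewrite /h1 oppr0; ring.
have h00 : h0 0 = 0 by rewrite /h0 oppr0; ring.
(* From [2 * L * t] the bounds become [L * t ^+ 2], then [L / 3 * t ^+ 3], then
   [L / 12 * t ^+ 4]. *)
have b2 := deriv_bound_integrate h20 D2 b3.
have b1 := deriv_bound_integrate h10 D1 b2.
have := deriv_bound_integrate h00 D0 b1 cc.
rewrite /h0 opprD addrA (mulrC (g2 0)) => /le_trans; apply.
by rewrite le_eqVlt; apply/orP; left; apply/eqP; field.
Qed.

End Taylor.

(** * Restriction of a multivariate function to a coordinate axis *)

Section AlongAxis.
Variables (R : realType) (n : nat).
Implicit Types (f : 'cV[R]_n -> R) (x : 'cV[R]_n) (i : 'I_n).

(** The difference quotient of the restriction at [t] is literally the directional one at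
    [x + t *: e]. *)
Lemma is_derive_axis f x i (t : R) :
  derivable f (x + t *: delta_mx i 0) (delta_mx i 0) ->
  is_derive t 1 (fun s : R => f (x + s *: delta_mx i 0))
    (partial i f (x + t *: delta_mx i 0)).
Proof.
set e := delta_mx i 0 => df; set g := fun s : R => _.
have E : (fun h : R => h^-1 *: ((g \o shift t) (h *: (1 : R)) - g t)) =
    (fun h : R => h^-1 *: ((f \o shift (x + t *: e)) (h *: e) - f (x + t *: e))).
  apply/funext => h /=; congr (_ *: (f _ - _)).
  by rewrite -[h *: 1]/(h * 1) mulr1 scalerDl addrCA.
by split; rewrite /derivable /derive /partial E.
Qed.

Lemma D3_delta f x i :
  D3 f x (delta_mx i 0) (delta_mx i 0) (delta_mx i 0) =
  partial i (partial i (partial i f)) x.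
Proof.
rewrite /D3 (bigD1 i)//= [X in _ + X]big1 => [|j ji]; last first.
  rewrite big1// => l _; rewrite big1// => m _.
  by rewrite !mxE (negbTE ji) mulr0 !mul0r.
rewrite addr0 (bigD1 i)//= [X in _ + X]big1 => [|j ji]; last first.
  by rewrite big1// => l _; rewrite !mxE (negbTE ji) mulr0 !mul0r.
rewrite addr0 (bigD1 i)//= [X in _ + X]big1 => [|j ji]; last first.
  by rewrite !mxE (negbTE ji) mulr0.
by rewrite !mxE !eqxx !mulr1 addr0.
Qed.

Lemma D3_le_trinorm f x y (u v w : 'cV[R]_n) :
  enorm u <= 1 -> enorm v <= 1 -> enorm w <= 1 ->
  `|D3 f x u v w - D3 f y u v w| <=
    trinorm (fun u v w => D3 f x u v w - D3 f y u v w).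
Proof.
move=> u1 v1 w1; apply: ub_le_sup; last by exists u, v, w.
(* [M x + M y] bounds the set whose supremum is [trinorm], so that this supremum dominates its
   members. *)
pose M z := \sum_i \sum_j \sum_l `|partial i (partial j (partial l f)) z|.
have bnd z (a b c : 'cV[R]_n) : enorm a <= 1 -> enorm b <= 1 -> enorm c <= 1 ->
    `|D3 f z a b c| <= M z.
  move=> a1 b1 c1; apply: le_trans (ler_norm_sum _ _ _) _.
  apply: ler_sum => i _; apply: le_trans (ler_norm_sum _ _ _) _.
  apply: ler_sum => j _; apply: le_trans (ler_norm_sum _ _ _) _.
  apply: ler_sum => l _; rewrite !normrM -!mulrA ler_piMr//.
  rewrite mulr_ile1 ?mulr_ge0 ?mulr_ile1//;
    exact: le_trans (coord_le_enorm _ _) _.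
exists (M x + M y) => _ [a [b [c [a1 b1 c1 ->]]]].
by apply: le_trans (ler_normB _ _) _; rewrite lerD ?bnd.
Qed.

Lemma CkS p (U : set 'cV[R]_n) f : Ck p.+1 U f -> Ck p U f.
Proof.
elim: p f => [|p IHp] f [cf df]; split=> // i.
by have [dfi /IHp] := df i.
Qed.

Lemma second_difference_axis f (U : set 'cV[R]_n) x i (L D c : R) :
  ecball x D `<=` U -> Ck 3 U f -> D3_lipschitz f (ecball x D) L ->
  `|c| <= D ->
  `|f (x + c *: delta_mx i 0) + f (x - c *: delta_mx i 0) - 2 * f x
    - c ^+ 2 * hessian f x i i| <= L / 12 * c ^+ 4.
Proof.
set e := delta_mx i 0 => ballU [_ /(_ i)[d1 [_ /(_ i)[d2 [_ /(_ i)[d3 _]]]]]] lip cD.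
have inB t : `|t| <= `|c| -> ecball x D (x + t *: e).
  move=> tc; rewrite /ecball/= addrC addKr enormZ enorm_delta mulr1.
  exact: le_trans tc cD.
pose g (F : 'cV[R]_n -> R) (t : R) := F (x + t *: e).
have g0 F : g F 0 = F x by rewrite /g scale0r addr0.
have := @second_difference_bound R (g f) (g (partial i f))
  (g (partial i (partial i f))) (g (partial i (partial i (partial i f)))) L c.
rewrite (g0 f) (g0 (partial i (partial i f))) /g scaleNr mxE; apply.
- by move=> t tc; apply: is_derive_axis; apply/d1/ballU/inB.
- by move=> t tc; apply: is_derive_axis; apply/d2/ballU/inB.
- by move=> t tc; apply: is_derive_axis; apply/d3/ballU/inB.
(* The third derivative along the axis is the trilinear form at the unit vectors [e, e, e], so its
   variation is controlled by [trinorm]. *)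
move=> s t sc tc; rewrite -!D3_delta.
apply: le_trans (D3_le_trinorm _ _ _ _ _ _) _; rewrite ?enorm_delta//.
apply: le_trans (lip _ _ (inB _ sc) (inB _ tc)) _.
by rewrite opprD addrACA subrr add0r -scalerBl enormZ enorm_delta mulr1.
Qed.

End AlongAxis.

(** * Error bound for the centered simplex Hessian diagonal *)

Theorem corollary3p6 (R : realType) (n k : nat) (f : 'cV[R]_n -> R)
    (U : set 'cV[R]_n) (x0 : 'cV[R]_n) (S : 'M[R]_(n, k)) (L : R)
    (hrad : 0 < mx_radius S)
    (hU : open U)
    (hball : ecball x0 (mx_radius S) `<=` U)
    (hf : Ck 4 U f)
    (hL0 : 0 <= L)
    (hL : D3_lipschitz f (ecball x0 (mx_radius S)) L)
    (hlonely : lonely S)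
    (hrank : row_free S) :
  let W := hadamard S S in
  let Wt := (mx_radius S ^+ 2)^-1 *: W in
  enorm (cshd f x0 S - diagv (hessian f x0)) <=
    opnorm (mpinv Wt^T) * (Num.sqrt k%:R / 12) * L * mx_radius S ^+ 2.
Proof.
cbv zeta; set W := hadamard S S; set D := mx_radius S in hrad hball hL *.
set Wt := _ *: W.
have D2 : D ^+ 2 != 0 by rewrite expf_neq0// gt_eqF.
have fW : row_free W by exact: row_free_hadamard.
have f3 : Ck 3 U f by exact: CkS.
pose r := eps_f f x0 S - W^T *m diagv (hessian f x0).
have -> : cshd f x0 S - diagv (hessian f x0) = mpinv W^T *m r.
  by rewrite mulmxBr mulmxA mul_mpinv_trmx// mul1mx.
(* Normalising [W] costs a factor [D ^- 2], which reduces the [D ^+ 4] of the residual bound to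
   [D ^+ 2]. *)
have WtE : mpinv W^T = (D ^+ 2)^-1 *: mpinv Wt^T.
  by rewrite /Wt linearZ/= mpinvZ ?invr_eq0// invrK scalerA mulVf// scale1r.
have rb : enorm r <= Num.sqrt k%:R * (L / 12 * D ^+ 4).
  apply: enorm_le_bound => [|j]; first by rewrite !mulr_ge0 ?exprn_ge0 ?(ltW hrad).
  have [i Sj] := lonely_col j hlonely.
  have cD : `|S i j| <= D.
    apply: le_trans (_ : enorm (col j S) <= _).
      by rewrite Sj enormZ enorm_delta mulr1.
    exact: (le_bigmax _ (fun j => enorm (col j S))).
  have -> : r j 0 = f (x0 + S i j *: delta_mx i 0) + f (x0 - S i j *: delta_mx i 0)
      - 2 * f x0 - S i j ^+ 2 * hessian f x0 i i.
    rewrite /r !mxE -Sj; congr (_ - _).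
    (* Only row [i] of column [j] is nonzero, so [W^T] picks out the single diagonal entry
       [hessian f x0 i i] with weight [S i j ^+ 2]. *)
    rewrite (bigD1 i)//= big1 => [|l li]; first by rewrite addr0 !mxE -expr2.
    have := congr1 (fun M : 'cV_n => M l 0) Sj.
    by rewrite !mxE (negbTE li) mulr0 => ->; rewrite !mul0r.
  apply: le_trans (@second_difference_axis _ _ f U x0 i L D _ hball f3 hL cD) _.
  rewrite ler_wpM2l ?divr_ge0//.
  have -> : S i j ^+ 4 = `|S i j| ^+ 4.
    by rewrite -[RHS]normrX ger0_norm// (exprM _ 2 2) sqr_ge0.
  by rewrite ler_pXn2r// nnegrE ltW.
rewrite WtE -scalemxAl enormZ gtr0_norm ?invr_gt0 ?exprn_gt0//.
rewrite mulrC ler_pdivrMr ?exprn_gt0//.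
apply: le_trans (enorm_mulmx_le _ _) _.
apply: le_trans (ler_wpM2l _ rb) _; first exact: opnorm_ge0.
by rewrite le_eqVlt; apply/orP; left; apply/eqP; field.
Qed.
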